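(* Consider an instance $G=(V,E\cup\overrightarrow{T})$ of Tree Augmentation. Partition $E$ into back edges $B$ and cross edges $C$; let $\overrightarrow{B}$ orient each back edge from descendant to ancestor; fix a depth-first search of $T$ from the root and let $\overrightarrow{C}$ orient each cross edge from lower to higher pre-order and $\overleftarrow{C}$ be the reverse orientation. Then whichever of the two orientations $\overrightarrow{B}\cup\overrightarrow{C}$ and $\overrightarrow{B}\cup\overleftarrow{C}$ covers more vertices is a feasible solution covering at least $\frac12$ of the maximum number of vertices covered by any feasible solution (i.e., it is a $\frac12$-approximation).
   Context: Tree Augmentation: the input is a mixed graph $G=(V,E\cup\overrightarrow{T})$ where $E$ is a set of undirected edges and $\overrightarrow{T}$ is a set of arcs forming a spanning tree of $V$ with all arcs directed towards a root (destination) vertex $d$. A feasible solution is an orientation $\overrightarrow{E'}$ of a subset $E'\subseteq E$ such that $(V,\overrightarrow{T}\cup\overrightarrow{E'})$ is acyclic. A vertex $u$ is covered if $\overrightarrow{E'}$ contains an arc $\overrightarrow{uv}$ leaving $u$. The objective is to maximize the number of covered vertices. Back edges are edges $uv\in E$ where one endpoint is a descendant of the other in the rooted tree $T$; cross edges are the remaining edges of $E$. Pre-order is the order in which the depth-first search first visits vertices. *)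

(* Defs.v *)
From mathcomp Require Import all_boot.

Set Implicit Arguments.
Unset Strict Implicit.
Unset Printing Implicit Defensive.

Section TreeAugmentation.
Variable V : finType.
Implicit Types (A T : {set V * V}) (E F : {set {set V}}) (d u v : V).

(* The pair (u, v) is the arc from u to v. *)
Definition arc A : rel V := [rel u v | (u, v) \in A].

Definition acyclic A : Prop := forall c : seq V, ucycle (arc A) c -> c = [::].

Definition underlying A : rel V := [rel u v | ((u, v) \in A) || ((v, u) \in A)].

(* A ucycle of a symmetric relation with two vertices is an edge traversed back
   and forth, so only those with at least three vertices are cycles of the
   underlying undirected graph.  The first clause excludes loops (u = v) and
   antiparallel arcs. *)
Definition spanning_tree_towards d T : Prop :=
  [/\ forall u v, (u, v) \in T -> (v, u) \notin T,
      forall u v, connect (underlying T) u v,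
      forall c : seq V, ucycle (underlying T) c -> size c <= 2
    & forall v, connect (arc T) v d].

Definition undirected_edges E : Prop := forall e, e \in E -> #|e| = 2.

Definition tree_augmentation_instance d T E : Prop :=
  spanning_tree_towards d T /\ undirected_edges E.

(* Exactly one of the two arcs is chosen for each edge of F, and A has no
   other arc. *)
Definition orientation_of F A : Prop :=
  (forall u v, (u, v) \in A -> [set u; v] \in F) /\
  (forall u v, [set u; v] \in F -> ((u, v) \in A) (+) ((v, u) \in A)).

Definition feasible T E A : Prop :=
  (exists2 F : {set {set V}}, F \subset E & orientation_of F A) /\
  acyclic (T :|: A).

Definition covered A : {set V} := [set u | [exists v, (u, v) \in A]].

(* Arcs of T point to the root, so u is a descendant of v when v can be reached
   from u along T. *)
Definition descendant T u v : bool := connect (arc T) u v.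

Definition back_edges T E : {set {set V}} :=
  [set e in E | [exists u, exists v, (e == [set u; v]) && descendant T u v]].

Definition cross_edges T E : {set {set V}} := E :\: back_edges T E.

(* A depth-first search of T from the root is determined by the order in which
   it tries the children of each vertex. *)
Definition child_order T (g : V -> seq V) : Prop :=
  forall x, perm_eq (g x) [seq y <- enum V | (y, x) \in T].

(* [dfs] puts each vertex in front of its accumulator at its first visit, so the
   visiting order is the reverse of its result. *)
Definition preorder d (g : V -> seq V) v : nat :=
  index v (rev (dfs g #|V| [::] d)).

Definition back_up T E : {set V * V} :=
  [set a : V * V | ([set a.1; a.2] \in back_edges T E) && descendant T a.1 a.2].

Definition cross_fwd d T E g : {set V * V} :=
  [set a : V * V | ([set a.1; a.2] \in cross_edges T E)
                   && (preorder d g a.1 < preorder d g a.2)].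

Definition cross_bwd d T E g : {set V * V} :=
  [set a : V * V | (a.2, a.1) \in cross_fwd d T E g].

(* A ranges over the candidates covering the most vertices, so in case of a tie
   both of them are considered. *)
Definition better_of A1 A2 A : Prop :=
  (A = A1 \/ A = A2) /\
  #|covered A1| <= #|covered A| /\ #|covered A2| <= #|covered A|.

End TreeAugmentation.

(* Main.v *)
(* Pre-order decreases along tree arcs, back arcs and right-to-left cross arcs,
   which makes the backward orientation acyclic.  For the forward orientation,
   the vertices of a subtree are visited contiguously, so the last visit time of
   a subtree increases along left-to-right cross arcs and does not decrease
   towards the root.  A feasible solution has no arc from an ancestor to a
   descendant, since such an arc would close a cycle with the tree; hence every
   vertex it covers has an edge to an ancestor or a cross edge, and is covered
   by one of the two orientations. *)
Require Import Defs.
From mathcomp Require Import all_boot.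

Set Implicit Arguments.
Unset Strict Implicit.
Unset Printing Implicit Defensive.

(** * Ranks and pairwise relations *)

Lemma acyclic_rank (V : finType) (A : {set V * V}) (f : V -> nat) :
  (forall u v, (u, v) \in A -> f u < f v) -> acyclic A.
Proof.
move=> fA [|x p] //= /andP[/= Axp _].
have ltn_f : transitive (relpre f ltn) by move=> y z t /=; apply: ltn_trans.
have /(order_path_min ltn_f)/allP/(_ x) : path (relpre f ltn) x (rcons p x).
  by apply: sub_path Axp => u v; apply: fA.
by rewrite mem_rcons mem_head /= ltnn => /(_ isT).
Qed.

Lemma in_pairwise (X : eqType) (r : rel X) (s : seq X) :
  {in s &, forall x y, r x y} -> pairwise r s.
Proof.
elim: s => //= x s IHs rs; apply/andP; split.
  by apply/allP => y sy; apply: rs; rewrite inE ?eqxx ?sy ?orbT.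
by apply: IHs => y z sy sz; apply: rs; rewrite inE ?sy ?sz orbT.
Qed.

(* The qualified name is needed because [path.arc] shadows [arc]. *)
Lemma arcE (V : finType) (A : {set V * V}) u v : Defs.arc A u v = ((u, v) \in A).
Proof. by []. Qed.

Lemma underlyingE (V : finType) (A : {set V * V}) u v :
  underlying A u v = ((u, v) \in A) || ((v, u) \in A).
Proof. by []. Qed.

(** * Ancestry in a tree directed towards its root *)

Section Tree.
Variables (V : finType) (d : V) (T : {set V * V}).
Hypothesis treeT : spanning_tree_towards d T.

(** A simple tree path from [v] to [u] would be closed by the arc into an undirected cycle. With at
    most two vertices, that cycle is a loop or a pair of antiparallel arcs. *)
Lemma arc_not_back u v : (u, v) \in T -> ~~ descendant T v u.
Proof.
case: treeT => anti _ noc _ Tuv; apply/negP => /connectP[p Tp].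
case/shortenP: Tp => {}p Tp Up _ def_u.
have /noc : ucycle (underlying T) (v :: p).
  rewrite /ucycle Up andbT /= rcons_path -def_u underlyingE Tuv andbT.
  by apply: sub_path Tp => x y; rewrite underlyingE -arcE => ->.
case: p Tp Up def_u => [|w [|//]] /= Tp _ def_u _.
  by move: Tuv (anti _ _ Tuv); rewrite def_u => ->.
by move: Tp; rewrite -def_u andbT arcE (negPf (anti _ _ Tuv)).
Qed.

Lemma descendant_anti u v : descendant T u v -> descendant T v u -> u = v.
Proof.
case/connectP=> [[|w p] /= Tp ->] // Dv; case/andP: Tp => Tuw Tp.
have /negP[] := arc_not_back Tuw; apply: connect_trans Dv.
by apply/connectP; exists p.
Qed.

(** The tree paths from [v] and [w] to the root avoid [u], as neither vertex descends to [u]. Hence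
    [v] and [w] are joined by an undirected path avoiding [u], and if they differ, [u] closes it
    into a cycle of at least three vertices. *)
Lemma parent_uniq u v w : (u, v) \in T -> (u, w) \in T -> v = w.
Proof.
move=> Tuv Tuw; apply/eqP; case: (treeT) => _ _ noc rootd.
(* The underlying tree with [u] deleted. *)
pose e := [rel x y | [&& underlying T x y, x != u & y != u]].
have sym_e : symmetric e.
  by move=> x y /=; rewrite !underlyingE orbC; congr (_ && _); rewrite andbC.
have avoid x : ~~ descendant T x u -> connect e x d.
  have /connectP[p Tp ->] := rootd x.
  elim: p x Tp => [|y p IHp] x //= /andP[Txy Tp] nDx.
  have nDy : ~~ descendant T y u.
    by apply: contra nDx; apply: connect_trans; apply: connect1.
  apply: connect_trans (IHp y Tp nDy); apply: connect1.
  rewrite /= underlyingE -arcE Txy /=; apply/andP; split.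
    by apply: contraNneq nDx => ->; apply: connect0.
  by apply: contraNneq nDy => ->; apply: connect0.
have /connectP[p ep def_w] : connect e v w.
  apply: connect_trans (avoid _ (arc_not_back Tuv)) _.
  by rewrite (sym_connect_sym sym_e); apply: avoid (arc_not_back Tuw).
apply: contraT => neq_vw; case/shortenP: ep def_w => {}p ep Up _ def_w.
have vNu : v != u.
  by apply: contraTneq (arc_not_back Tuv) => ->; rewrite negbK; apply: connect0.
have uNp : u \notin p.
  elim: p v ep {Up def_w neq_vw Tuv vNu} => //= y p IHp x /andP[/and3P[_ _ yNu] ep].
  by rewrite inE eq_sym negb_or yNu (IHp y).
have /noc : ucycle (underlying T) [:: u, v & p].
  rewrite /ucycle; apply/andP; split.
    rewrite /= underlyingE Tuv /= rcons_path -def_w underlyingE Tuw orbT andbT.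
    by apply: sub_path ep => x y /and3P[].
  by rewrite cons_uniq Up inE eq_sym negb_or vNu uNp.
by case: p def_w {ep Up uNp} neq_vw => //= ->; rewrite eqxx.
Qed.

Lemma descendant_parent u v w :
  (u, v) \in T -> descendant T u w -> u != w -> descendant T v w.
Proof.
move=> Tuv /connectP[[|x p] /= Tp ->]; first by rewrite eqxx.
case/andP: Tp => Tux Tp _; rewrite (parent_uniq Tuv Tux).
by apply/connectP; exists p.
Qed.

(** Parents are unique, so only one path leads upwards from [w], and both [u] and [v] lie on it. *)
Lemma descendant_comparable u v w :
  descendant T w u -> descendant T w v -> descendant T u v || descendant T v u.
Proof.
case/connectP=> p; elim: p w => [|x p IHp] w /= => [_ -> -> //|].
case/andP=> Twx Tp def_u Dwv; have [eq_wv | neq_wv] := eqVneq w v.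
  apply/orP; right; rewrite -eq_wv; apply/connectP; exists (x :: p) => //=.
  by rewrite Twx.
exact: IHp Tp def_u (descendant_parent Twx Dwv neq_wv).
Qed.

(** If distinct siblings were comparable, say [y] below [z], then their parent [x] would also be
    below [z], against [arc_not_back]. *)
Lemma siblings_disjoint x y z w : (y, x) \in T -> (z, x) \in T ->
  descendant T w y -> descendant T w z -> y = z.
Proof.
move=> Tyx Tzx Dwy Dwz; apply/eqP; apply: contraT => neq_yz.
case/orP: (descendant_comparable Dwy Dwz) => [Dyz | Dzy].
  by have := arc_not_back Tzx; rewrite (descendant_parent Tyx Dyz).
by have := arc_not_back Tyx; rewrite (descendant_parent Tzx Dzy) // eq_sym.
Qed.

End Tree.

(** * Depth-first search as a recursive tour *)

Section Tour.
Variables (V : finType) (d : V) (T : {set V * V}) (g : V -> seq V).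
Hypotheses (treeT : spanning_tree_towards d T) (orderg : child_order T g).

(** The fuel [n] bounds the depth as in [dfs], but no visited set is kept, and the vertices come out
    in visiting order. *)
Fixpoint tour n x : seq V :=
  if n is n'.+1 then x :: flatten [seq tour n' y | y <- g x] else [::].

Lemma mem_children x y : (y \in g x) = ((y, x) \in T).
Proof. by rewrite (perm_mem (orderg x)) mem_filter mem_enum andbT. Qed.

Lemma uniq_children x : uniq (g x).
Proof. by rewrite (perm_uniq (orderg x)) filter_uniq ?enum_uniq. Qed.

Lemma tour_descendant n x w : w \in tour n x -> descendant T w x.
Proof.
elim: n x => [|n IHn] x //=; rewrite inE => /predU1P[-> | ]; first exact: connect0.
case/flattenP=> _ /mapP[y gy ->] /IHn Dwy; apply: connect_trans Dwy _.
by apply: connect1; rewrite arcE -mem_children.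
Qed.

(* In a tree the test [x \in v] of [dfs] never succeeds: siblings have disjoint
   subtrees, so nothing below [x] has been visited before [x]. *)
Lemma dfs_tour n v x : (forall w, w \in v -> ~~ descendant T w x) ->
  dfs g n v x = rev (tour n x) ++ v.
Proof.
elim: n v x => [|n IHn] v x vNx /=; first by case: ifP.
have xNv : x \notin v by apply/negP => /vNx; rewrite /descendant connect0.
rewrite (negPf xNv) rev_cons cat_rcons.
(* The accumulator grows from child to child, so the claim is generalized to the remaining children
   [s] and any [v1] with no vertex below them. *)
suff fold_tour s v1 : uniq s -> {subset s <= g x} ->
    (forall w y, w \in v1 -> y \in s -> ~~ descendant T w y) ->
    foldl (dfs g n) v1 s = rev (flatten [seq tour n y | y <- s]) ++ v1.
  apply: fold_tour; rewrite ?uniq_children // => w y.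
  rewrite mem_children inE => /predU1P[-> | /vNx wNx] Tyx.
    exact: arc_not_back treeT _ _ Tyx.
  by apply: contra wNx => /connect_trans; apply; apply: connect1.
elim: s v1 => [|y s IHs] v1 //= /andP[yNs Us] sub_s vNs.
have gy : y \in g x by apply: sub_s; rewrite mem_head.
rewrite IHn => [|w vw]; last by rewrite vNs ?mem_head.
rewrite IHs //; first by rewrite rev_cat catA.
  by move=> z sz; apply: sub_s; rewrite inE sz orbT.
move=> w z; rewrite mem_cat mem_rev => /orP[/tour_descendant Dwy | vw] sz.
  apply: contra yNs => Dwz; suff -> : y = z by [].
  move: gy (sub_s z); rewrite inE sz orbT !mem_children => Tyx /(_ isT) Tzx.
  exact: siblings_disjoint treeT _ _ _ _ Tyx Tzx Dwy Dwz.
  by rewrite vNs // inE sz orbT.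
Qed.

(** If one vertex descended from the other, it would lie below two distinct children of [x]. *)
Lemma tour_siblings n x y s u w : {subset y :: s <= g x} -> y \notin s ->
    u \in tour n y -> w \in flatten [seq tour n z | z <- s] ->
  ~~ descendant T u w /\ ~~ descendant T w u.
Proof.
move=> sub_s yNs /tour_descendant Duy /flattenP[_ /mapP[z sz ->]].
move/tour_descendant=> Dwz.
have disj t : descendant T t y -> descendant T t z -> false.
  move=> Dty Dtz; rewrite -(negPf yNs); suff -> : y = z by [].
  have Tyx : (y, x) \in T by rewrite -mem_children sub_s ?mem_head.
  have Tzx : (z, x) \in T by rewrite -mem_children sub_s // inE sz orbT.
  exact: siblings_disjoint treeT _ _ _ _ Tyx Tzx Dty Dtz.
split; apply/negP => D; first by have := disj u Duy (connect_trans D Dwz).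
by have := disj w (connect_trans D Duy) Dwz.
Qed.

Lemma tour_topdown n x :
  pairwise (fun u w => ~~ descendant T u w) (tour n x).
Proof.
elim: n x => //= n IHn x; apply/andP; split.
  apply/allP => w /flattenP[_ /mapP[y gy ->]] /tour_descendant Dwy.
  have Tyx : (y, x) \in T by rewrite -mem_children.
  by apply: contra (arc_not_back treeT Tyx) => /connect_trans; apply.
(* This trivial inclusion lets the induction run over suffixes of [g x] while recording that they
   consist of children of [x]. *)
have : {subset g x <= g x} by [].
elim: {1 2 4}(g x) (uniq_children x) => [|y s IHs] //= /andP[yNs Us] sub_s; rewrite pairwise_cat IHn /=.
rewrite IHs // ?andbT => [|z sz]; last by apply: sub_s; rewrite inE sz orbT.
by apply/allrelP=> u w yu sw; case: (tour_siblings sub_s yNs yu sw).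
Qed.

(* In [s], the descendants of each vertex [u] form a block starting right after
   [u]. *)
Fixpoint contiguous (s : seq V) : bool :=
  if s is u :: s' then
    pairwise (fun v w => descendant T w u ==> descendant T v u) s'
    && contiguous s'
  else true.

(** For [u] in [s1], every new pair has its later element in [s2], hence not below [u], and the
    implication is vacuous. *)
Lemma contiguous_cat s1 s2 : contiguous s1 -> contiguous s2 ->
    (forall u w, u \in s1 -> w \in s2 -> ~~ descendant T w u) ->
  contiguous (s1 ++ s2).
Proof.
move=> + cs2; elim: s1 => //= u s1 IHs1 /andP[pu cs1] sep; apply/andP; split.
  have sep_u w : w \in s2 -> descendant T w u = false.
    by move=> s2w; apply: negPf; apply: sep; rewrite ?mem_head.
  rewrite pairwise_cat pu /=; apply/andP; split.
    by apply/allrelP => v w _ /sep_u ->.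
  by apply: in_pairwise => v w _ /sep_u ->.
by apply: IHs1 => // v w s1v; apply: sep; rewrite inE s1v orbT.
Qed.

Lemma tour_contiguous n x : contiguous (tour n x).
Proof.
elim: n x => //= n IHn x; apply/andP; split.
  apply: in_pairwise => v w fv _; apply/implyP => _.
  by apply: (@tour_descendant n.+1); rewrite /= inE fv orbT.
have : {subset g x <= g x} by [].
elim: {1 2 4}(g x) (uniq_children x) => [|y s IHs] //= /andP[yNs Us] sub_s; apply: contiguous_cat => //.
  by apply: IHs => // z sz; apply: sub_s; rewrite inE sz orbT.
by move=> u w yu sw; case: (tour_siblings sub_s yNs yu sw).
Qed.

Lemma pairwise_index (r : rel V) s u v : pairwise r s ->
  v \in s -> index u s < index v s -> r u v.
Proof.
move=> /(pairwiseP u) rs sv lt_uv; have su : u \in s.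
  by rewrite -index_mem; apply: ltn_trans lt_uv _; rewrite index_mem.
by rewrite -(nth_index u su) -(nth_index u sv) rs ?inE ?index_mem.
Qed.

Lemma contiguous_index s u v w : contiguous s -> w \in s ->
    index u s < index v s -> index v s <= index w s -> descendant T w u ->
  descendant T v u.
Proof.
have [-> // | neq_vw] := eqVneq v w.
elim: s => //= x s IHs /andP[px cs]; rewrite inE.
case: (eqVneq x v) => [-> | neq_xv] // ; case: (eqVneq x w) => [-> | neq_xw] //.
move=> /= sw; case: (eqVneq x u) => [<- _|_]; last first.
  by rewrite !ltnS; apply: IHs.
(* An absent element has index [size s], so sharing the index of [w] would put [v] in [s] and force
   [v = w]. *)
rewrite ltnS leq_eqVlt => /orP[/eqP eq_vw | lt_vw].
  have sv : v \in s by rewrite -index_mem eq_vw index_mem.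
  by case/eqP: neq_vw; rewrite -(nth_index v sv) eq_vw nth_index.
exact/implyP/(pairwise_index px sw lt_vw).
Qed.

(** * Pre-order and the rank for the forward orientation *)

Local Notation pre := (preorder d g).

Lemma visits_tour : rev (dfs g #|V| [::] d) = tour #|V| d.
Proof. by rewrite dfs_tour // cats0 revK. Qed.

(** That the fuel [#|V|] suffices is inherited from [dfsP], applied to the reversed tree path from
    [v] to [d]. *)
Lemma mem_tour v : v \in tour #|V| d.
Proof.
rewrite -visits_tour mem_rev; apply/dfsP.
have [_ _ _ /(_ v)/connectP[p Tp ->]] := treeT.
exists (rev (belast v p)); last first.
  by case: p {Tp} => //= x p; rewrite rev_cons last_rcons.
rewrite rev_path; apply: sub_path Tp => x y /=.
by rewrite mem_children.
Qed.

Lemma preorder_lt_card v : pre v < size (tour #|V| d).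
Proof. by rewrite /preorder visits_tour index_mem mem_tour. Qed.

Lemma preorder_inj : injective pre.
Proof.
rewrite /preorder visits_tour => u v eq_uv.
by rewrite -(nth_index u (mem_tour u)) eq_uv nth_index // mem_tour.
Qed.

Lemma preorder_descendant u v : descendant T u v -> u != v -> pre v < pre u.
Proof.
move=> Duv neq_uv; rewrite ltn_neqAle (inj_eq preorder_inj) eq_sym neq_uv /=.
rewrite leqNgt; apply: contraL Duv; rewrite /preorder visits_tour.
exact: pairwise_index (tour_topdown _ _) (mem_tour v).
Qed.

Lemma preorder_contiguous u v w :
  pre u < pre v -> pre v <= pre w -> descendant T w u -> descendant T v u.
Proof.
rewrite /preorder visits_tour; apply: contiguous_index (mem_tour w).
exact: tour_contiguous.
Qed.

Definition last_visit u := \max_(w | descendant T w u) pre w.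

(* Encodes the lexicographic order on [last_visit] and decreasing pre-order. *)
Definition up_right_rank u :=
  last_visit u * (size (tour #|V| d)).+1 + (size (tour #|V| d) - pre u).

(** The last visit may be the same for [u] and [v]; the strict drop in pre-order then decides. *)
Lemma up_right_rank_descendant u v :
  descendant T u v -> u != v -> up_right_rank u < up_right_rank v.
Proof.
move=> Duv neq_uv; rewrite -addnS leq_add //.
  rewrite leq_mul2r; apply/orP; right; apply/bigmax_leqP => w Dwu.
  by apply: leq_bigmax_cond; apply: connect_trans Duv.
by rewrite ltn_sub2l ?preorder_lt_card // preorder_descendant.
Qed.

(** A descendant of [u] visited at [v] or later would, by contiguity, put [v] below [u]. So the
    subtree of [u] is finished before [v] is visited. *)
Lemma up_right_rank_cross u v :
  ~~ descendant T v u -> pre u < pre v -> up_right_rank u < up_right_rank v.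
Proof.
move=> nDvu lt_uv; have lt_last : last_visit u < last_visit v.
  apply: (@leq_trans (pre v)); last exact/leq_bigmax_cond/connect0.
  (* [bigmax_leqP] gives only a weak bound, so [pre v] is written as a successor. *)
  rewrite -(ltn_predK lt_uv) ltnS; apply/bigmax_leqP => w Dwu.
  rewrite -ltnS (ltn_predK lt_uv) ltnNge; apply: contra nDvu => le_vw.
  exact: preorder_contiguous lt_uv le_vw Dwu.
(* The second component is at most the tour size, so one extra multiple of its successor outweighs
   it. *)
apply: leq_trans (leq_addr _ _); apply: leq_trans (leq_mul lt_last (leqnn _)).
by rewrite mulSnr /up_right_rank ltn_add2l ltnS leq_subr.
Qed.

End Tour.

(** * Feasibility and coverage of the two orientations *)

Section Orientations.
Variables (V : finType) (d : V) (T : {set V * V}) (E : {set {set V}}).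
Variable g : V -> seq V.
Hypotheses (instG : tree_augmentation_instance d T E) (orderg : child_order T g).

Let treeT : spanning_tree_towards d T := proj1 instG.
Local Notation pre := (preorder d g).

Lemma edge_neq u v : [set u; v] \in E -> u != v.
Proof. by case: instG => _ E2 /E2; rewrite cards2; case: eqP. Qed.

Lemma mem_back_edges u v : ([set u; v] \in back_edges T E) =
  ([set u; v] \in E) && (descendant T u v || descendant T v u).
Proof.
rewrite inE; congr (_ && _); apply/existsP/idP; last first.
  case/orP=> D; [exists u | exists v]; apply/existsP; [exists v | exists u].
    by rewrite eqxx.
  by rewrite setUC eqxx.
case=> x /existsP[y /andP[/eqP eq_xy Dxy]].
(* Equality of the unordered pairs is used through memberships; in the cases with [x = y] they force
   [u = v]. *)
have: (x \in [set u; v]) && (y \in [set u; v]) by rewrite eq_xy !inE !eqxx orbT.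
have: (u \in [set x; y]) && (v \in [set x; y]) by rewrite -eq_xy !inE !eqxx orbT.
rewrite !inE => + /andP[/orP[]/eqP ex /orP[]/eqP ey]; subst x y.
- by case/andP=> _; rewrite orbb => /eqP->; rewrite Dxy.
- by rewrite Dxy.
- by rewrite Dxy orbT.
- by case/andP; rewrite orbb => /eqP->; rewrite Dxy.
Qed.

Lemma mem_cross_edges u v : ([set u; v] \in cross_edges T E) =
  [&& [set u; v] \in E, ~~ descendant T u v & ~~ descendant T v u].
Proof.
by rewrite inE mem_back_edges; case: (_ \in E); rewrite ?negb_or ?andbF ?andbT.
Qed.

Lemma mem_back_up u v :
  ((u, v) \in back_up T E) = ([set u; v] \in E) && descendant T u v.
Proof.
rewrite inE /= mem_back_edges.
by case: (descendant T u v); rewrite ?andbF ?andbT.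
Qed.

Lemma mem_cross_fwd u v : ((u, v) \in cross_fwd d T E g) =
  [&& [set u; v] \in E, ~~ descendant T u v, ~~ descendant T v u & pre u < pre v].
Proof. by rewrite inE /= mem_cross_edges -!andbA. Qed.

Lemma mem_cross_bwd u v : ((u, v) \in cross_bwd d T E g) =
  [&& [set u; v] \in E, ~~ descendant T u v, ~~ descendant T v u & pre v < pre u].
Proof.
by rewrite inE /= mem_cross_fwd setUC; congr (_ && _); rewrite andbCA.
Qed.

Lemma arc_descendant u v : (u, v) \in T -> descendant T u v /\ u != v.
Proof.
move=> Tuv; split; first exact: connect1.
by apply: contraTneq (arc_not_back treeT Tuv) => ->; rewrite negbK; apply: connect0.
Qed.

Lemma descendant_edge u v :
  [set u; v] \in E -> descendant T u v -> ~~ descendant T v u.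
Proof.
move=> Euv Duv; apply: contra (edge_neq Euv) => Dvu.
exact/eqP/(descendant_anti treeT).
Qed.

Lemma preorder_edge u v :
  [set u; v] \in E -> (pre u < pre v) (+) (pre v < pre u).
Proof.
move/edge_neq; rewrite -(inj_eq (preorder_inj treeT orderg)).
by case: ltngtP.
Qed.

Lemma feasible_fwd : feasible T E (back_up T E :|: cross_fwd d T E g).
Proof.
split.
  (* Every edge is oriented: ancestry is antisymmetric on back edges, and distinct pre-orders settle
     cross edges. *)
  exists E => //; split=> u v.
    by rewrite in_setU mem_back_up mem_cross_fwd => /orP[]/andP[].
  move=> Euv; have := descendant_edge Euv; have := preorder_edge Euv.
  rewrite !in_setU !mem_back_up !mem_cross_fwd [[set v; u]]setUC Euv /=.
  by case: (descendant T u v) => [_ /(_ isT)|]; case: (descendant T v u).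
apply: (@acyclic_rank _ _ (up_right_rank d T g)) => u v.
rewrite !in_setU mem_back_up mem_cross_fwd => /or3P[Tuv | /andP[Euv Duv] | ].
- by have [Duv neq_uv] := arc_descendant Tuv; apply: up_right_rank_descendant.
- by apply: up_right_rank_descendant => //; apply: edge_neq.
- by case/and4P=> _ _; apply: up_right_rank_cross.
Qed.

Lemma feasible_bwd : feasible T E (back_up T E :|: cross_bwd d T E g).
Proof.
split.
  exists E => //; split=> u v.
    by rewrite in_setU mem_back_up mem_cross_bwd => /orP[]/andP[].
  move=> Euv; have := descendant_edge Euv; have := preorder_edge Euv.
  rewrite !in_setU !mem_back_up !mem_cross_bwd [[set v; u]]setUC Euv /=.
  rewrite addbC; case: (descendant T u v) => [_ /(_ isT)|];
    by case: (descendant T v u).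
(* Pre-order falls along every arc, so its complement to the tour size is a rank. *)
apply: (@acyclic_rank _ _ (fun u => size (tour g #|V| d) - pre u)) => u v.
rewrite !in_setU mem_back_up mem_cross_bwd => Auv.
rewrite ltn_sub2l ?(preorder_lt_card treeT) //.
case/or3P: Auv => [Tuv | /andP[Euv Duv] | /and4P[] //].
- by have [Duv neq_uv] := arc_descendant Tuv; apply: (preorder_descendant treeT).
- by apply: (preorder_descendant treeT) => //; apply: edge_neq.
Qed.

Lemma feasible_not_down S u v :
  feasible T E S -> (u, v) \in S -> [set u; v] \in E /\ ~~ descendant T v u.
Proof.
case=> [[F sFE [SF _]] acS] Suv.
have Euv : [set u; v] \in E by rewrite (subsetP sFE) ?SF.
split=> //; apply/negP => /connectP[p Tp].
case/shortenP: Tp => {}p Tp Up _ def_u.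
suff /acS : ucycle (Defs.arc (T :|: S)) (v :: p) by [].
rewrite /ucycle Up andbT /= rcons_path -def_u arcE in_setU Suv orbT andbT.
by apply: sub_path Tp => x y; rewrite !arcE in_setU => ->.
Qed.

Lemma covered_feasible S : feasible T E S ->
  covered S \subset covered (back_up T E :|: cross_fwd d T E g)
                :|: covered (back_up T E :|: cross_bwd d T E g).
Proof.
move=> feasS; apply/subsetP => u; rewrite !inE => /existsP[v Suv].
have [Euv nDvu] := feasible_not_down feasS Suv.
have [Duv | nDuv] := boolP (descendant T u v).
  (* Back arcs belong to both orientations, so either side would do here. *)
  by apply/orP; left; apply/existsP; exists v; rewrite in_setU mem_back_up Euv Duv.
have := preorder_edge Euv; have [lt_uv _ | _ /= lt_vu] := boolP (pre u < pre v).
  apply/orP; left; apply/existsP; exists v.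
  by rewrite in_setU mem_cross_fwd Euv nDuv nDvu lt_uv orbT.
apply/orP; right; apply/existsP; exists v.
by rewrite in_setU mem_cross_bwd Euv nDuv nDvu lt_vu orbT.
Qed.

End Orientations.

Theorem theorem1 (V : finType) (d : V) (T : {set V * V}) (E : {set {set V}})
    (g : V -> seq V) (A : {set V * V})
    (hG : tree_augmentation_instance d T E)
    (hg : child_order T g)
    (hA : better_of (back_up T E :|: cross_fwd d T E g)
                    (back_up T E :|: cross_bwd d T E g) A) :
  feasible T E A /\
  (forall S : {set V * V}, feasible T E S -> #|covered S| <= 2 * #|covered A|).
Proof.
case: hA => defA [le_fwd le_bwd]; split.
  by case: defA => ->; [apply: feasible_fwd | apply: feasible_bwd].
(* The factor 2 is the union bound: each of the two covered sets has at most [#|covered A|]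
   vertices. *)
move=> S /(covered_feasible hG hg)/subset_leq_card/leq_trans; apply.
apply: leq_trans (leq_card_setU _ _) _.
by rewrite mul2n -addnn leq_add.
Qed.
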